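(* Let $K$ be a field, $n\ge 1$, and let $L$ be the infinite multivariate Pascal matrix, i.e. $L=\big(\binom{\bf k}{\bf k'}\big)_{{\bf k},{\bf k'}\in\mathbb{Z}^n_{\geq 0}}$. The powers of $L$ are all elements of the multivariate Riordan group. More precisely, for every integer $p$, \[L^p=\mathcal R\big(G({\bf z}),X_1({\bf z}),\ldots,X_n({\bf z})\big),\] where \[G({\bf z})=\frac{1}{\prod_{j=1}^n(1-pz_j)},\qquad X_i({\bf z})=\frac{z_i}{1-pz_i}\quad\mbox{for }1\leq i\leq n.\]
   Context: Notation: for ${\bf k},{\bf i}\in\mathbb{Z}^n_{\geq 0}$, $|{\bf k}|=k_1+\cdots+k_n$; ${\bf i}\le{\bf k}$ means $i_j\le k_j$ for all $j$; $\binom{\bf k}{\bf i}=\prod_{j=1}^n\binom{k_j}{i_j}$, with $\binom{\bf k}{\bf i}=0$ if ${\bf i}\not\le{\bf k}$; ${\bf z}^{\bf k}=z_1^{k_1}\cdots z_n^{k_n}$. The rows and columns of $L$ are indexed by $\mathbb{Z}^n_{\geq 0}$, ordered by the total order $<_T$: ${\bf k}<_T{\bf k'}$ iff $|{\bf k}|<|{\bf k'}|$, or $|{\bf k}|=|{\bf k'}|$ and the left-most nonzero entry of ${\bf k'}-{\bf k}$ is negative. $L$ is lower triangular with ones on the diagonal, so all its integer powers are defined ($L^p=(L^{-1})^{-p}$ for $p<0$); the integer entries of $L^p$ are regarded as elements of $K$. Multivariate Riordan group: in $K[[z_1,\ldots,z_n]]$ with maximal ideal $\mathfrak m=(z_1,\ldots,z_n)$,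 power series $X_1,\ldots,X_n\in\mathfrak m$ form a set of variables if $\det\big(\frac{\partial X_j}{\partial z_i}({\bf 0})\big)_{i,j}\neq 0$. The Riordan group is the set of all $(G,{\bf X})$ with $G\in K[[z_1,\ldots,z_n]]$ invertible and ${\bf X}=(X_1,\ldots,X_n)$ a set of variables, with product $(G,{\bf X})\star(H,{\bf Y})=(G\,H({\bf X}),{\bf Y}({\bf X}))$, where $H({\bf X})$ and ${\bf Y}({\bf X})$ denote substitution of ${\bf X}$ for ${\bf z}$. The element $(G,{\bf X})$ is represented by the infinite matrix $\mathcal R(G,{\bf X})=\mathcal R(G,X_1,\ldots,X_n)=(a_{{\bf i}{\bf j}})_{{\bf i},{\bf j}\in\mathbb{Z}^n_{\geq 0}}$ determined by \[G\,{\bf X}^{\bf j}=\sum_{{\bf i}\in\mathbb{Z}^n_{\geq 0}}a_{{\bf i}{\bf j}}\,{\bf z}^{\bf i}\qquad\text{for all }{\bf j}\in\mathbb{Z}^n_{\geq 0},\] where ${\bf X}^{\bf j}=X_1^{j_1}\cdots X_n^{j_n}$. A matrix is called an element of the multivariate Riordan group if it equals $\mathcal R(G,{\bf X})$ for some $(G,{\bf X})$ in the Riordan group. *)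

(* Defs.v *)
From HB Require Import structures.
From mathcomp Require Import all_boot all_order all_algebra.
From mathcomp Require Import mpoly.
From mathcomp Require Import boolp.

Set Implicit Arguments.
Unset Strict Implicit.
Unset Printing Implicit Defensive.

Import Order.TTheory GRing.Theory.
Local Open Scope ring_scope.

Section BoundedSums.
Variables (V : nmodType) (n : nat).

Lemma bmnm_widen (d e : nat) (F : 'X_{1..n} -> V) : (d <= e)%N ->
    (forall l, (d < mdeg l)%N -> F l = 0) ->
  \sum_(l : 'X_{1..n < e.+1}) F l = \sum_(l : 'X_{1..n < d.+1}) F l.
Proof.
move=> le_de F0; rewrite (bigID (fun l : 'X_{1..n < e.+1} => (mdeg l < d.+1)%N)) /=.
rewrite [X in _ + X]big1 ?addr0; last first.
  by move=> l; rewrite -leqNgt => /F0.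
have lt_e (l : 'X_{1..n < d.+1}) : (mdeg l < e.+1)%N.
  exact: leq_trans (bmdeg l) _.
rewrite (reindex (fun l : 'X_{1..n < d.+1} => BMultinom (lt_e l))) /=; last first.
  exists (fun l : 'X_{1..n < e.+1} => insubd (bm0 : 'X_{1..n < d.+1}) (val l)).
    by move=> l _; apply: val_inj; rewrite insubdK //; exact: (bmdeg l).
  by move=> l lt_l; apply: val_inj => /=; rewrite insubdK.
by apply: eq_big => // l; rewrite bmdeg.
Qed.

Lemma bmnm_sum1 (d : nat) (k : 'X_{1..n}) (F : 'X_{1..n} -> V) :
    (mdeg k < d)%N -> (forall l, l != k -> F l = 0) ->
  \sum_(l : 'X_{1..n < d}) F l = F k.
Proof.
move=> lt_k F0; rewrite (bigD1 (BMultinom lt_k)) //= big1 ?addr0 //.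
by move=> l; rewrite -val_eqE => /F0.
Qed.

End BoundedSums.

Section GradedOrder.
Variable n : nat.
Implicit Types k l m : 'X_{1..n}.

(* The total order <_T. It is not the order of [mpoly], whose ties between
   multi-indices of equal degree are broken in the opposite direction. *)
Definition ltT k k' : bool :=
  (mdeg k < mdeg k')%N ||
  (mdeg k == mdeg k') &&
    [exists j : 'I_n, (k' j < k j)%N &&
                      [forall i : 'I_n, (i < j)%N ==> (k' i == k i)]].

Lemma ltTE k k' :
  ltT k k' = (mdeg k < mdeg k')%N || (mdeg k == mdeg k') && (k' < k)%O.
Proof.
rewrite /ltT; case: (mdeg k =P mdeg k') => //= eqd; congr (_ || _).
apply/existsP/(ltmcP (esym eqd)) => [[j /andP[ltj /forallP eqj]]|[j eqj ltj]].
  by exists j => // i ltij; have := eqj i; rewrite ltij => /eqP.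
exists j; rewrite ltj; apply/forallP => i; apply/implyP => ltij.
by rewrite eqj.
Qed.

Lemma ltT_irr k : ltT k k = false.
Proof. by rewrite ltTE ltnn eqxx ltxx. Qed.

Lemma ltT_trans : transitive ltT.
Proof.
move=> l k m; rewrite !ltTE.
case: (ltngtP (mdeg k) (mdeg l)) => //= [ltkl _|-> ltkl].
  case: (ltngtP (mdeg l) (mdeg m)) => //= [ltlm _|<- _]; last by rewrite ltkl.
  by rewrite (ltn_trans ltkl ltlm).
by case: ltngtP => //= _ ltlm; apply: lt_trans ltkl.
Qed.

Lemma ltT_total k l : k != l -> ltT k l || ltT l k.
Proof.
move=> neq; rewrite !ltTE; case: ltngtP => //= _.
by rewrite -neq_lt eq_sym.
Qed.

Lemma ltT_mdeg k l : ltT k l -> (mdeg k <= mdeg l)%N.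
Proof. by rewrite ltTE; case: (ltngtP (mdeg k)). Qed.

Lemma ltT_cotrans l k m : ltT k m -> ltT k l || ltT l m.
Proof.
move=> ltkm; case: (boolP (ltT k l)) => //= nkl.
have [<-//|/ltT_total] := eqVneq k l.
by rewrite (negPf nkl) /= => ltlk; apply: ltT_trans ltkm.
Qed.

Lemma ltT_wf : well_founded (fun k l => ltT k l).
Proof.
move=> k0; have [d led] : exists d, (mdeg k0 <= d)%N by exists (mdeg k0).
pose r l := #|[pred m : 'X_{1..n < d.+1} | ltT m l]|.
have [N ltN] : exists N, (r k0 < N)%N by exists (r k0).+1; exact: ltnSn.
elim: N k0 ltN led => [k|N IH k ltN led]; first by rewrite ltn0.
split=> l ltlk; have led' := leq_trans (ltT_mdeg ltlk) led.
apply: (IH l _ led'); apply: leq_trans (ltN : (r k <= N)%N).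
apply: proper_card; apply/properP; split.
  by apply/subsetP => m; rewrite !inE => /ltT_trans; apply.
by exists (BMultinom (led' : (mdeg l < d.+1)%N)); rewrite !inE //= ltT_irr.
Qed.

End GradedOrder.

Record ltmx (R : nzRingType) (n : nat) := Ltmx {
  ltmx_fun :> 'X_{1..n} -> 'X_{1..n} -> R;
  ltmx_upper0 : forall k k', ltT k k' -> ltmx_fun k k' = 0
}.

HB.instance Definition _ (R : nzRingType) (n : nat) := gen_eqMixin (ltmx R n).
HB.instance Definition _ (R : nzRingType) (n : nat) :=
  gen_choiceMixin (ltmx R n).

Section LowerTriangular.
Variables (R : nzRingType) (n : nat).
Implicit Types A B C : ltmx R n.
Local Notation idx := 'X_{1..n}.

Lemma ltmxP A B : (forall k k', A k k' = B k k') -> A = B.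
Proof.
case: A B => [f f0] [g g0] /= eq_fg.
have {eq_fg}eq_fg : f = g by apply/funext => k; apply/funext => k'.
by case: g / eq_fg g0 => g0; congr Ltmx; apply: Prop_irrelevance.
Qed.

Lemma ltmx_mdeg A k k' : (mdeg k < mdeg k')%N -> A k k' = 0.
Proof. by move=> ltk; apply: ltmx_upper0; rewrite /ltT ltk. Qed.

Fact ltmx0_subproof (k k' : idx) : ltT k k' -> 0 = 0 :> R.
Proof. by []. Qed.
Definition ltmx0 : ltmx R n := @Ltmx R n (fun _ _ => 0) ltmx0_subproof.

Fact ltmx1_subproof (k k' : idx) : ltT k k' -> (k == k')%:R = 0 :> R.
Proof. by case: eqP => // ->; rewrite ltT_irr. Qed.
Definition ltmx1 : ltmx R n := Ltmx ltmx1_subproof.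

Fact ltmx_opp_subproof A (k k' : idx) : ltT k k' -> - A k k' = 0 :> R.
Proof. by move=> /ltmx_upper0->; rewrite oppr0. Qed.
Definition ltmx_opp A : ltmx R n := Ltmx (@ltmx_opp_subproof A).

Fact ltmx_add_subproof A B (k k' : idx) : ltT k k' -> A k k' + B k k' = 0 :> R.
Proof. by move=> ltk; rewrite !ltmx_upper0 ?addr0. Qed.
Definition ltmx_add A B : ltmx R n := Ltmx (@ltmx_add_subproof A B).

(* In row k, A k l = 0 as soon as |l| > |k|: the finite range below carries all
   the nonzero terms of the sum over every multi-index l. *)
Definition ltmx_mul_fun A B (k k' : idx) : R :=
  \sum_(l : 'X_{1..n < (mdeg k).+1}) A k l * B l k'.
Fact ltmx_mul_subproof A B (k k' : idx) :
  ltT k k' -> ltmx_mul_fun A B k k' = 0.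
Proof.
move=> ltk; rewrite /ltmx_mul_fun big1 // => l _.
by case/orP: (ltT_cotrans l ltk) => /ltmx_upper0->; rewrite ?mul0r ?mulr0.
Qed.
Definition ltmx_mul A B : ltmx R n := Ltmx (@ltmx_mul_subproof A B).

Lemma ltmx_mul_widen A B d (k k' : idx) : (mdeg k <= d)%N ->
  ltmx_mul_fun A B k k' = \sum_(l : 'X_{1..n < d.+1}) A k l * B l k'.
Proof.
move=> le_kd; rewrite (@bmnm_widen _ _ (mdeg k) d (fun l => A k l * B l k')) //.
by move=> l /ltmx_mdeg->; rewrite mul0r.
Qed.

Fact ltmx_addA : associative ltmx_add.
Proof. by move=> A B C; apply: ltmxP => k k' /=; rewrite addrA. Qed.
Fact ltmx_addC : commutative ltmx_add.
Proof. by move=> A B; apply: ltmxP => k k' /=; rewrite addrC. Qed.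
Fact ltmx_add0 : left_id ltmx0 ltmx_add.
Proof. by move=> A; apply: ltmxP => k k' /=; rewrite add0r. Qed.
Fact ltmx_addN : left_inverse ltmx0 ltmx_opp ltmx_add.
Proof. by move=> A; apply: ltmxP => k k' /=; rewrite addNr. Qed.

Fact ltmx_mulA : associative ltmx_mul.
Proof.
move=> A B C; apply: ltmxP => k k'.
rewrite /= [LHS]/ltmx_mul_fun [RHS]/ltmx_mul_fun /=.
under [RHS]eq_bigr do rewrite /ltmx_mul_fun big_distrl /=.
rewrite [RHS]exchange_big /=; apply: eq_bigr => l _.
rewrite (@ltmx_mul_widen B C (mdeg k) l k'); last by rewrite -ltnS bmdeg.
by rewrite big_distrr /=; apply: eq_bigr => m _; rewrite mulrA.
Qed.
Fact ltmx_mul1l : left_id ltmx1 ltmx_mul.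
Proof.
move=> A; apply: ltmxP => k k'; rewrite /= /ltmx_mul_fun /=.
rewrite (@bmnm_sum1 _ _ _ k (fun l => (k == l)%:R * A l k')) //.
  by rewrite eqxx mul1r.
by move=> l; rewrite eq_sym => /negPf->; rewrite mul0r.
Qed.
Fact ltmx_mul1r : right_id ltmx1 ltmx_mul.
Proof.
move=> A; apply: ltmxP => k k'.
rewrite /= (ltmx_mul_widen _ _ _ (leq_maxl (mdeg k) (mdeg k'))) /=.
rewrite (@bmnm_sum1 _ _ _ k' (fun l => A k l * (l == k')%:R)) //.
- by rewrite eqxx mulr1.
- by rewrite ltnS leq_maxr.
- by move=> l /negPf->; rewrite mulr0.
Qed.
Fact ltmx_mulDl : left_distributive ltmx_mul ltmx_add.
Proof.
move=> A B C; apply: ltmxP => k k'; rewrite /= /ltmx_mul_fun -big_split /=.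
by apply: eq_bigr => l _; rewrite mulrDl.
Qed.
Fact ltmx_mulDr : right_distributive ltmx_mul ltmx_add.
Proof.
move=> A B C; apply: ltmxP => k k'; rewrite /= /ltmx_mul_fun -big_split /=.
by apply: eq_bigr => l _; rewrite mulrDr.
Qed.
Fact ltmx_oner_neq0 : ltmx1 != ltmx0.
Proof.
apply/eqP => /(congr1 (fun A : ltmx R n => A 0%MM 0%MM)) /= /eqP.
by rewrite eqxx oner_eq0.
Qed.

Definition ltmx_unit A : bool := `[< exists B, ltmx_mul B A = ltmx1 /\
                                               ltmx_mul A B = ltmx1 >].
Definition ltmx_inv A : ltmx R n :=
  if pselect (exists B, ltmx_mul B A = ltmx1 /\ ltmx_mul A B = ltmx1)
    is left exB then projT1 (cid exB) else A.

Fact ltmx_mulVl A : ltmx_unit A -> ltmx_mul (ltmx_inv A) A = ltmx1.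
Proof.
move/asboolP; rewrite /ltmx_inv; case: pselect => // exB _.
by case: (cid exB) => B [].
Qed.
Fact ltmx_mulVr A : ltmx_unit A -> ltmx_mul A (ltmx_inv A) = ltmx1.
Proof.
move/asboolP; rewrite /ltmx_inv; case: pselect => // exB _.
by case: (cid exB) => B [].
Qed.
Fact ltmx_unitP A B :
  ltmx_mul B A = ltmx1 /\ ltmx_mul A B = ltmx1 -> ltmx_unit A.
Proof. by move=> AB; apply/asboolP; exists B. Qed.
Fact ltmx_inv_out A : ~~ ltmx_unit A -> ltmx_inv A = A.
Proof. by move/asboolP; rewrite /ltmx_inv; case: pselect. Qed.

HB.instance Definition _ := GRing.isZmodule.Build (ltmx R n)
  ltmx_addA ltmx_addC ltmx_add0 ltmx_addN.
HB.instance Definition _ := GRing.Zmodule_isNzRing.Build (ltmx R n)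
  ltmx_mulA ltmx_mul1l ltmx_mul1r ltmx_mulDl ltmx_mulDr ltmx_oner_neq0.
HB.instance Definition _ := GRing.NzRing_hasMulInverse.Build (ltmx R n)
  ltmx_mulVl ltmx_mulVr ltmx_unitP ltmx_inv_out.

Lemma ltmx1E (k k' : idx) : (1 : ltmx R n) k k' = (k == k')%:R.
Proof. by []. Qed.

Lemma ltmxME A B (k k' : idx) :
  (A * B) k k' = \sum_(l : 'X_{1..n < (mdeg k).+1}) A k l * B l k'.
Proof. by []. Qed.

Lemma unitriangular_rinv A : (forall k, A k k = 1) ->
  exists2 B : ltmx R n, (forall k, B k k = 1) & A * B = 1.
Proof.
move=> A1.
pose step (k : idx) (rec : forall l : idx, ltT l k -> idx -> R) (k' : idx) : R :=
  (k == k')%:R - \sum_(l : 'X_{1..n < (mdeg k).+1})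
    A k l * (if @idP (ltT l k) is ReflectT h then rec l h k' else 0).
pose b := Fix (@ltT_wf n) (fun=> idx -> R) step.
have aux (P : Prop) (c : bool) (r : reflect P c) (x y : R) :
    x * (if r is ReflectT _ then y else 0) = if c then x * y else 0.
  by case: r => // _; rewrite mulr0.
have bE k k' : b k k' = (k == k')%:R -
    \sum_(l : 'X_{1..n < (mdeg k).+1} | ltT l k) A k l * b l k'.
  rewrite {1}/b Fix_eq => [|x f g eq_fg].
    rewrite {1}/step [in RHS]big_mkcond /=; congr (_ - _).
    by apply: eq_bigr => l _; apply: aux.
  have -> // : f = g.
  by apply: functional_extensionality_dep => l;
     apply: functional_extensionality_dep => h.
have b0 k k' : ltT k k' -> b k k' = 0.
  elim/(well_founded_ind (@ltT_wf n)): k => k IH ltk.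
  rewrite bE big1 => [|l ltl]; last first.
    by rewrite (IH l ltl (ltT_trans ltl ltk)) mulr0.
  by case: eqP ltk => [->|]; rewrite ?ltT_irr ?subr0.
exists (Ltmx b0) => [k|] /=.
  rewrite bE eqxx big1 ?subr0 // => l ltl.
  by rewrite b0 ?mulr0.
apply: ltmxP => k k'; rewrite ltmxME ltmx1E /=.
rewrite (bigID (fun l : 'X_{1..n < (mdeg k).+1} => ltT l k)) /=.
rewrite [X in _ + X](bigD1 (BMultinom (ltnSn (mdeg k)))) /=; last first.
  by rewrite ltT_irr.
rewrite A1 mul1r.
rewrite [X in _ + (_ + X)]big1 ?addr0; last first.
  move=> l /andP[nlt]; rewrite -val_eqE /= => neq.
  have := ltT_total neq; rewrite (negPf nlt) /= => /ltmx_upper0->.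
  by rewrite mul0r.
by rewrite [X in _ + X]bE addrC subrK.
Qed.

Lemma unitriangular_unit A : (forall k, A k k = 1) -> A \is a GRing.unit.
Proof.
move=> A1; have [B B1 AB] := unitriangular_rinv A1.
have [C _ BC] := unitriangular_rinv B1.
have BA : B * A = 1 by rewrite -[A]mulr1 -BC (mulrA A) AB mul1r.
by apply/unitrP; exists B.
Qed.

End LowerTriangular.

Definition mbin (n : nat) (k i : 'X_{1..n}) : nat :=
  (\prod_(j < n) 'C(k j, i j))%N.

Lemma mbin_out (n : nat) (k i : 'X_{1..n}) : ~~ (i <= k)%MM -> mbin k i = 0%N.
Proof.
rewrite negb_forall => /existsP[j]; rewrite -ltnNge => ltj.
by apply/eqP; rewrite /mbin (bigD1 j) //= bin_small // mul0n.
Qed.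

Fact pascal_subproof (n : nat) (k k' : 'X_{1..n}) :
  ltT k k' -> (mbin k k')%:Z = 0.
Proof.
move=> ltk; rewrite mbin_out //; apply/negP => /mnm_lepP lek.
have ek : k = (k - k' + k')%MM by rewrite submK //; apply/mnm_lepP.
move: ltk; rewrite ek; move: (k - k')%MM => d.
rewrite ltTE ltnNge mdegD leq_addl /= -{2}[mdeg k']add0n eqn_add2r mdeg_eq0.
by case/andP=> /eqP->; rewrite add0m ltxx.
Qed.

Definition pascal (n : nat) : ltmx int n := Ltmx (@pascal_subproof n).

(* Hence [pascal n ^ p] is meaningful for every p : int: no inverse is a default
   value. *)
Lemma pascal_unit (n : nat) : pascal n \is a GRing.unit.
Proof.
apply: unitriangular_unit => k /=.
by rewrite /mbin big1 // => j _; rewrite binn.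
Qed.

Definition infmx (K : Type) (n : nat) := 'X_{1..n} -> 'X_{1..n} -> K.

Definition ltmx_int_to (K : nzRingType) (n : nat) (A : ltmx int n) : infmx K n :=
  fun k k' => (A k k')%:~R.
Arguments ltmx_int_to K {n} A.

Record mfps (R : comUnitRingType) (n : nat) := Mfps {
  mfps_coef :> 'X_{1..n} -> R
}.

HB.instance Definition _ (R : comUnitRingType) (n : nat) :=
  gen_eqMixin (mfps R n).
HB.instance Definition _ (R : comUnitRingType) (n : nat) :=
  gen_choiceMixin (mfps R n).

Section PowerSeries.
Variables (R : comUnitRingType) (n : nat).
Local Notation idx := 'X_{1..n}.
Implicit Types f g h : mfps R n.

Lemma mfpsP f g : (forall m, f m = g m) -> f = g.
Proof. by case: f g => [f] [g] /= /funext->. Qed.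

Definition mfps0 : mfps R n := Mfps (fun=> 0).
Definition mfps1 : mfps R n := Mfps (fun m => (m == 0%MM)%:R).
Definition mfps_opp f : mfps R n := Mfps (fun m => - f m).
Definition mfps_add f g : mfps R n := Mfps (fun m => f m + g m).
Definition mfps_mul f g : mfps R n := Mfps (fun m =>
  \sum_(k : 'X_{1..n < (mdeg m).+1} | (k <= m)%MM) f k * g (m - k)%MM).

Definition mfps_trunc d f : {mpoly R[n]} :=
  \sum_(m : 'X_{1..n < d}) f m *: 'X_[m].

Lemma mfps_truncE d f (m : idx) : (mdeg m < d)%N -> (mfps_trunc d f)@_m = f m.
Proof. exact: mcoeff_mpoly. Qed.

Lemma mpolyM_trunc d (p q p' q' : {mpoly R[n]}) (m : idx) : (mdeg m < d)%N ->
    (forall k, (mdeg k < d)%N -> p@_k = p'@_k) ->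
    (forall k, (mdeg k < d)%N -> q@_k = q'@_k) ->
  (p * q)@_m = (p' * q')@_m.
Proof.
move=> ltm eqp eqq; rewrite !mcoeffM; apply: eq_bigr => -[k1 k2] /= _.
by rewrite eqp ?eqq //; apply: leq_trans (bmdeg _) _.
Qed.

Lemma mfps_mulE d f g (m : idx) : (mdeg m < d)%N ->
  mfps_mul f g m = (mfps_trunc d f * mfps_trunc d g)@_m.
Proof.
move=> ltm; rewrite [RHS](mcoeff_poly_mul_lin _ _ (k := (mdeg m).+1)) //=.
apply: eq_bigr => k lek; rewrite !mfps_truncE //.
  exact: leq_ltn_trans (mdegB _ _) ltm.
exact: leq_trans (bmdeg k) ltm.
Qed.

Lemma mfps_trunc_mul d f g (m : idx) : (mdeg m < d)%N ->
  (mfps_trunc d (mfps_mul f g))@_m = (mfps_trunc d f * mfps_trunc d g)@_m.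
Proof. by move=> ltm; rewrite mfps_truncE // (mfps_mulE _ _ ltm). Qed.

Fact mfps_addA : associative mfps_add.
Proof. by move=> f g h; apply: mfpsP => m /=; rewrite addrA. Qed.
Fact mfps_addC : commutative mfps_add.
Proof. by move=> f g; apply: mfpsP => m /=; rewrite addrC. Qed.
Fact mfps_add0 : left_id mfps0 mfps_add.
Proof. by move=> f; apply: mfpsP => m /=; rewrite add0r. Qed.
Fact mfps_addN : left_inverse mfps0 mfps_opp mfps_add.
Proof. by move=> f; apply: mfpsP => m /=; rewrite addNr. Qed.
Fact mfps_mulA : associative mfps_mul.
Proof.
move=> f g h; apply: mfpsP => m; have ltm := ltnSn (mdeg m).
rewrite !(mfps_mulE _ _ ltm).
rewrite (mpolyM_trunc (p' := mfps_trunc (mdeg m).+1 f)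
  (q' := mfps_trunc (mdeg m).+1 g * mfps_trunc (mdeg m).+1 h) ltm) //.
  rewrite mulrA; apply/esym.
  by apply: (mpolyM_trunc ltm) => // k ltk; rewrite mfps_trunc_mul.
by move=> k ltk; rewrite mfps_trunc_mul.
Qed.
Fact mfps_mulC : commutative mfps_mul.
Proof.
move=> f g; apply: mfpsP => m.
by rewrite !(mfps_mulE _ _ (ltnSn (mdeg m))) mulrC.
Qed.
Fact mfps_mul1 : left_id mfps1 mfps_mul.
Proof.
move=> f; apply: mfpsP => m; have ltm := ltnSn (mdeg m).
rewrite (mfps_mulE _ _ ltm).
rewrite (mpolyM_trunc (p' := 1) (q' := mfps_trunc (mdeg m).+1 f) ltm) //.
  by rewrite mul1r mfps_truncE.
by move=> k ltk; rewrite mfps_truncE // mcoeff1.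
Qed.
Fact mfps_mulDl : left_distributive mfps_mul mfps_add.
Proof.
move=> f g h; apply: mfpsP => m; rewrite /= -big_split /=.
by apply: eq_bigr => k _; rewrite mulrDl.
Qed.
Fact mfps_oner_neq0 : mfps1 != mfps0.
Proof.
apply/eqP => /(congr1 (fun f : mfps R n => f 0%MM)) /= /eqP.
by rewrite eqxx oner_eq0.
Qed.

HB.instance Definition _ := GRing.isZmodule.Build (mfps R n)
  mfps_addA mfps_addC mfps_add0 mfps_addN.
HB.instance Definition _ := GRing.Zmodule_isComNzRing.Build (mfps R n)
  mfps_mulA mfps_mulC mfps_mul1 mfps_mulDl mfps_oner_neq0.

Definition mfps_unit f : bool := `[< exists g, g * f = 1 >].
Definition mfps_inv f : mfps R n :=
  if pselect (exists g, g * f = 1) is left exg then projT1 (cid exg) else f.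

Fact mfps_mulV : {in mfps_unit, left_inverse 1 mfps_inv *%R}.
Proof.
move=> f /asboolP; rewrite /mfps_inv; case: pselect => // exg _.
by case: (cid exg).
Qed.
Fact mfps_unitP f g : g * f = 1 -> mfps_unit f.
Proof. by move=> gf; apply/asboolP; exists g. Qed.
Fact mfps_inv_out : {in [predC mfps_unit], mfps_inv =1 id}.
Proof. by move=> f /asboolP; rewrite /mfps_inv; case: pselect. Qed.

HB.instance Definition _ := GRing.ComNzRing_hasMulInverse.Build (mfps R n)
  mfps_mulV mfps_unitP mfps_inv_out.

Definition mfps_var (i : 'I_n) : mfps R n := Mfps (fun m => (m == U_(i)%MM)%:R).

Definition mfps_deriv (i : 'I_n) f : mfps R n :=
  Mfps (fun m => f (m + U_(i))%MM *+ (m i).+1).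

Definition in_maxideal f : Prop :=
  exists a : 'I_n -> mfps R n, f = \sum_(i < n) a i * mfps_var i.

Definition mfps_jacobian0 (X : 'I_n -> mfps R n) : 'M[R]_n :=
  \matrix_(i, j) mfps_deriv i (X j) 0%MM.

End PowerSeries.

Arguments mfps_var R {n} i.

Section Riordan.
Variables (K : fieldType) (n : nat).

Definition variables_set (X : 'I_n -> mfps K n) : Prop :=
  (forall i, in_maxideal (X i)) /\ \det (mfps_jacobian0 X) != 0.

Definition riordan_pair (G : mfps K n) (X : 'I_n -> mfps K n) : Prop :=
  G \is a GRing.unit /\ variables_set X.

(* Column j lists the coefficients of G X^j. *)
Definition riordan_mx (G : mfps K n) (X : 'I_n -> mfps K n) : infmx K n :=
  fun i j => (G * \prod_(l < n) X l ^+ j l : mfps K n) i.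

Definition riordan_element (M : infmx K n) : Prop :=
  exists G X, riordan_pair G X /\ M = riordan_mx G X.

End Riordan.

(* Main.v *)
Require Import Defs.
From mathcomp Require Import all_boot all_order all_algebra.
From mathcomp Require Import mpoly.
From mathcomp Require Import boolp.
Import GRing.Theory.
Local Open Scope ring_scope.

(** L^p has entries p^(|k|-|j|) binom(k, j). Indeed the k-th row of the matrix
    Q_p with these entries is the coefficient sequence of the polynomial
    prod_l (x_l + p)^(k_l), so that Q_p Q_q = Q_(p+q) by composition of
    translations, while Q_0 = 1 and Q_1 = L. On the other hand, by Pascal's rule
    the generating series f_j of the j-th column satisfies
    (1 - p z_l) f_(j + e_l) = z_l f_j and prod_l (1 - p z_l) f_0 = 1, which gives
    f_j = G X^j. *)

(** * Multi-indices and Pascal's rule in one variable at a time *)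

Lemma mnm_ind {n : nat} (P : 'X_{1..n} -> Prop) :
    P 0%MM -> (forall m l, P m -> P (m + U_(l))%MM) -> forall m, P m.
Proof.
move=> P0 PS m; have [d] := ubnP (mdeg m); elim: d m => // d IH m ltm.
have [->//|] := eqVneq m 0%MM.
rewrite -mdeg_eq0 mdegE sum_nat_eq0 negb_forall => /existsP[l].
rewrite implyTb => ml.
have leU : (U_(l) <= m)%MM by rewrite lep1mP.
rewrite -(submK leU); apply/PS/IH.
by move: ltm; rewrite -{1}(submK leU) mdegD mdeg1 addn1 ltnS.
Qed.

Lemma mnm_split {n : nat} (l : 'I_n) (m : 'X_{1..n}) :
  m l = 0%N \/ exists m', m = (m' + U_(l))%MM.
Proof.
have [|ml] := eqVneq (m l) 0%N; first by left.
by right; exists (m - U_(l))%MM; rewrite submK // lep1mP.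
Qed.

Lemma mbin0 {n : nat} (k : 'X_{1..n}) : mbin k 0%MM = 1%N.
Proof. by rewrite /mbin big1 // => j _; rewrite mnm0E bin0. Qed.

Lemma mbin_addU {n : nat} (k j : 'X_{1..n}) (l : 'I_n) :
  mbin (k + U_(l))%MM (j + U_(l))%MM = (mbin k (j + U_(l))%MM + mbin k j)%N.
Proof.
rewrite /mbin [LHS](bigD1 l) //= [X in _ = (X + _)%N](bigD1 l) //=.
rewrite [X in _ = (_ + X)%N](bigD1 l) //= !mnmDE mnm1E eqxx !addn1 binS mulnDl.
congr (_ * _ + _ * _)%N; apply: eq_bigr => i neq_il;
  by rewrite !mnmDE mnm1E eq_sym (negPf neq_il) !addn0.
Qed.

Lemma mbin_addU0 {n : nat} (k j : 'X_{1..n}) (l : 'I_n) :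
  j l = 0%N -> mbin (k + U_(l))%MM j = mbin k j.
Proof.
move=> jl0; apply: eq_bigr => i _; rewrite mnmDE mnm1E.
by case: eqP => [<-|_]; rewrite ?addn0 // jl0 !bin0.
Qed.

(** * Entries of Q_p and their row polynomials *)

Section PascalCoef.
Context {R : comNzRingType} {n : nat}.
Implicit Types (p q : R) (k j m : 'X_{1..n}).

(** Truncated subtraction is harmless: when |k| < |j| the binomial vanishes. A general ring [R]
    serves both the integer matrix and its image in K. *)
Definition pascal_coef p k j : R := p ^+ (mdeg k - mdeg j) *+ mbin k j.

Lemma pascal_coef_out p k j : ~~ (j <= k)%MM -> pascal_coef p k j = 0.
Proof. by move=> nle; rewrite /pascal_coef mbin_out. Qed.

Lemma pascal_coef_addU p k j (l : 'I_n) :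
  pascal_coef p (k + U_(l))%MM (j + U_(l))%MM =
  pascal_coef p k j + p * pascal_coef p k (j + U_(l))%MM.
Proof.
rewrite {1}/pascal_coef mbin_addU mulrnDr addrC !mdegD mdeg1 subnDr.
(* Only for [j + U_(l) <= k] is the exponent |k| - |j| a true successor; otherwise both terms
   vanish. *)
congr (_ + _); have [lejk|nle] := boolP (j + U_(l) <= k)%MM; last first.
  by rewrite pascal_coef_out // mbin_out // mulr0.
rewrite /pascal_coef mulrnAr -exprS mdegD mdeg1 -subSn.
  by rewrite addn1 subSS.
by rewrite -(submK lejk) !mdegD mdeg1 leq_addl.
Qed.

Lemma pascal_coef_addU0 p k j (l : 'I_n) : j l = 0%N ->
  pascal_coef p (k + U_(l))%MM j = p * pascal_coef p k j.
Proof.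
move=> jl0; rewrite /pascal_coef mbin_addU0 //.
have [lejk|nle] := boolP (j <= k)%MM; last by rewrite mbin_out // mulr0.
rewrite mulrnAr -exprS mdegD mdeg1 addn1 subSn //.
by rewrite -(submK lejk) mdegD leq_addl.
Qed.

Lemma pascal_coef0r p k : pascal_coef p k 0%MM = p ^+ mdeg k.
Proof. by rewrite /pascal_coef mbin0 mdeg0 subn0. Qed.

Lemma pascal_coef0l p j : pascal_coef p 0%MM j = (j == 0%MM)%:R.
Proof.
have [->|neq] := eqVneq; first by rewrite pascal_coef0r mdeg0.
rewrite pascal_coef_out //; apply: contra neq => /mnm_lepP le0.
by apply/eqP/mnmP => i; apply/eqP; move: (le0 i); rewrite mnm0E leqn0.
Qed.

(** Multiplication by x_l + p acts on coefficients by the recurrences for [k + U_(l)], with or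
    without x_l in the monomial j. *)
Lemma pascal_row p k j :
  (\prod_(l < n) ('X_l + p%:MP) ^+ k l : {mpoly R[n]})@_j = pascal_coef p k j.
Proof.
elim/(@mnm_ind n): k j => [j|k l IH j].
  rewrite pascal_coef0l big1 ?mcoeff1 // => l _.
  by rewrite mnm0E.
have -> : \prod_(i < n) ('X_i + p%:MP) ^+ (k + U_(l))%MM i =
    ('X_l + p%:MP) * \prod_(i < n) ('X_i + p%:MP) ^+ k i :> {mpoly R[n]}.
  under eq_bigr do rewrite mnmDE exprD.
  rewrite big_split /= mulrC; congr (_ * _).
  rewrite (bigD1 l) //= mnm1E eqxx big1 ?mulr1 // => i neq_il.
  by rewrite mnm1E eq_sym (negPf neq_il).
rewrite mulrDl mcoeffD mcoeffCM IH mulrC.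
have [jl0|[j' ->]] := mnm_split l j.
  (* A multiple of x_l has no monomial free of x_l. *)
  rewrite pascal_coef_addU0 // memN_msupp_eq0 ?add0r //.
  rewrite (perm_mem (msuppMX _ _)); apply/mapP => -[m _ ej].
  by move: jl0; rewrite ej mnmDE mnm1E eqxx.
by rewrite pascal_coef_addU {1}addmC mcoeffMX IH.
Qed.

End PascalCoef.

(** * The one-parameter group of integer powers of L *)

Section PascalPower.
Context {n : nat}.
Implicit Types p q : int.

Fact pascal_pow_subproof p (k k' : 'X_{1..n}) :
  ltT k k' -> pascal_coef p k k' = 0.
Proof.
by move=> /(@ltmx_upper0 _ _ (pascal n)) [kk'0]; rewrite /pascal_coef kk'0.
Qed.
Definition pascal_pow p : Defs.ltmx int n := Ltmx (@pascal_pow_subproof p).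

Lemma pascal_pow0 : pascal_pow 0 = 1.
Proof.
(* At p = 0 the row polynomial is the monomial x^k. *)
apply: ltmxP => k j; rewrite -[LHS]/(pascal_coef 0 k j) ltmx1E -pascal_row.
under eq_bigr do rewrite mpolyC0 addr0.
by rewrite -mpolyXE_id mcoeffX.
Qed.

Lemma pascal_pow1 : pascal_pow 1 = pascal n.
Proof.
apply: ltmxP => k j; rewrite -[LHS]/(pascal_coef 1 k j) /pascal_coef expr1n.
by rewrite -[RHS]/((mbin k j)%:Z) natz.
Qed.

(* Row k of a product of matrices is the row polynomial of the left factor with
   the row polynomials of the right factor substituted for its monomials. *)
Lemma pascal_powD p q : pascal_pow (p + q) = pascal_pow p * pascal_pow q.
Proof.
apply: ltmxP => k j; rewrite ltmxME -[LHS]/(pascal_coef (p + q) k j).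
pose row (r : int) m : {mpoly int[n]} := \prod_(l < n) ('X_l + r%:MP) ^+ m l.
pose shift : n.-tuple {mpoly int[n]} := [tuple 'X_l + q%:MP | l < n].
have row_comp : row (p + q) k = row p k \mPo shift.
  rewrite rmorph_prod; apply: eq_bigr => l _.
  rewrite rmorphXn /= comp_mpolyD comp_mpolyC comp_mpolyXU.
  rewrite -tnth_nth tnth_mktuple.
  by rewrite -addrA -mpolyCD [q + p]addrC.
(* This degree bound makes the expansion of the composition range over the index set of the matrix
   product. *)
have size_row : (msize (row p k) <= (mdeg k).+1)%N.
  rewrite msizeE; apply/bigmax_leqP_seq => m; rewrite mcoeff_msupp pascal_row.
  case: (boolP (m <= k)%MM) => [lemk _ _|nle]; last first.
    by rewrite pascal_coef_out ?eqxx.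
  by rewrite ltnS -(submK lemk) mdegD leq_addl.
rewrite -pascal_row -/(row _ _) row_comp (comp_mpolywE _ size_row) raddf_sum.
apply: eq_bigr => m _; rewrite /= mcoeffZ pascal_row; congr (_ * _).
by rewrite -pascal_row; under eq_bigr do rewrite tnth_mktuple.
Qed.

Lemma pascal_exprz p : pascal n ^ p = pascal_pow p.
Proof.
have powS (m : nat) : pascal n ^+ m = pascal_pow m.
  elim: m => [|m IH]; first by rewrite pascal_pow0.
  by rewrite exprS IH -pascal_pow1 -pascal_powD -intS.
case: p => m; first exact: powS.
(* For negative exponents, Q_(m+1) is cancelled against Q_(-(m+1)), their product being Q_0 = 1. *)
have powU : pascal_pow m.+1 \is a GRing.unit.
  by rewrite -powS unitrX ?pascal_unit.
rewrite -[LHS]/(pascal n ^- m.+1) powS; apply: (mulrI powU).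
by rewrite NegzE mulrV // -pascal_powD subrr pascal_pow0.
Qed.

End PascalPower.

(** * Generating series of the columns *)

Section PascalSeries.
Context {R : comUnitRingType} {n : nat}.
Implicit Types (f : mfps R n) (p : int) (m j : 'X_{1..n}) (l : 'I_n).

Lemma mfps_coef_mulrz f p m : (f *~ p) m = f m *~ p.
Proof.
have nat_case (d : nat) : (f *+ d) m = f m *+ d.
  by elim: d => // d IH; rewrite !mulrS -IH.
case: p => d; first exact: nat_case.
by rewrite !NegzE !mulrNz -!pmulrn -nat_case.
Qed.

Lemma mfps_mulXE f m l : (mfps_var R l * f) (m + U_(l))%MM = f m.
Proof.
rewrite -[LHS]/(mfps_mul (mfps_var R l) f _) /=.
have lt1 : (mdeg U_(l) < (mdeg (m + U_(l))).+1)%N.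
  by rewrite ltnS mdegD leq_addl.
rewrite (bigD1 (BMultinom lt1)) ?lem_addl //= eqxx mul1r addmK big1 ?addr0 //.
by move=> k /andP[_]; rewrite -val_eqE => /negPf /= ->; rewrite mul0r.
Qed.

Lemma mfps_mulXE0 f m l : m l = 0%N -> (mfps_var R l * f) m = 0.
Proof.
move=> ml0; rewrite -[LHS]/(mfps_mul (mfps_var R l) f _) /= big1 // => k lek.
have [ek|] := eqVneq; last by rewrite mul0r.
by move: lek; rewrite ek lep1mP ml0.
Qed.

Definition pascal_col p j : mfps R n := Mfps (fun m => pascal_coef p%:~R m j).

Lemma mfps_mul1BXE f p m l :
  ((1 - p%:~R * mfps_var R l) * f) m = f m - p%:~R * (mfps_var R l * f) m.
Proof. by rewrite mulrBl mul1r -mulrA !mulrzl -mfps_coef_mulrz. Qed.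

Lemma pascal_col_addU p j l :
  (1 - p%:~R * mfps_var R l) * pascal_col p (j + U_(l))%MM =
  mfps_var R l * pascal_col p j.
Proof.
apply: mfpsP => m; rewrite mfps_mul1BXE.
have [ml0|[m' ->]] := mnm_split l m.
  (* Here z_l does not occur in m, so [j + U_(l) <= m] fails. *)
  rewrite !mfps_mulXE0 // mulr0 subr0 /= pascal_coef_out //.
  by apply/mnm_lepP => /(_ l); rewrite mnmDE mnm1E eqxx ml0 addn1.
by rewrite !mfps_mulXE /= pascal_coef_addU addrK.
Qed.

Lemma pascal_col0 p :
  \prod_(l < n) (1 - p%:~R * mfps_var R l) * pascal_col p 0%MM = 1.
Proof.
(* The coefficients p^|m| are geometric in each exponent, so multiplying by
   1 - p z_l keeps only the terms free of z_l. *)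
have partial (s : seq 'I_n) m : uniq s ->
    (\prod_(l <- s) (1 - p%:~R * mfps_var R l) * pascal_col p 0%MM) m =
    if all (fun l => m l == 0%N) s then p%:~R ^+ mdeg m else 0.
  elim: s m => [|l s IH] m; first by rewrite big_nil mul1r /= pascal_coef0r.
  rewrite [uniq _]/= [all _ _]/= => /andP[ls uniq_s].
  rewrite big_cons -mulrA mfps_mul1BXE IH //.
  have [ml0|[m' em]] := mnm_split l m.
    by rewrite mfps_mulXE0 // mulr0 subr0 ml0.
  have -> : (m l == 0%N) = false by rewrite em mnmDE mnm1E eqxx addn1.
  (* Since [l] is not in [s], removing one z_l leaves the tested exponents unchanged. *)
  have -> : all (fun i => m i == 0%N) s = all (fun i => m' i == 0%N) s.
    apply: eq_in_all => i si; rewrite em mnmDE mnm1E.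
    by case: (l =P i) si ls => [->->|]; rewrite ?addn0.
  rewrite em mfps_mulXE IH // mdegD mdeg1 addn1 exprS.
  by case: ifP; rewrite ?mulr0 subrr.
apply: mfpsP => m; rewrite partial ?index_enum_uniq //= -[RHS]/((m == 0%MM)%:R).
have -> : all (fun l => m l == 0%N) (index_enum 'I_n) = (m == 0%MM).
  apply/allP/eqP => [m0|-> l _]; last by rewrite mnm0E.
  by apply/mnmP => l; rewrite mnm0E; apply/eqP/m0; rewrite mem_index_enum.
by have [->|] := eqVneq; rewrite ?mdeg0.
Qed.

Lemma unit_prod_1BpX p :
  (\prod_(l < n) (1 - p%:~R * mfps_var R l) : mfps R n) \is a GRing.unit.
Proof.
by apply/unitrPr; exists (pascal_col p 0%MM); apply: pascal_col0.
Qed.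

(** In a commutative ring every factor of a unit is a unit. *)
Lemma unit_1BpX p l : (1 - p%:~R * mfps_var R l : mfps R n) \is a GRing.unit.
Proof.
by have /unitr_prodP := unit_prod_1BpX p; apply; rewrite ?mem_index_enum.
Qed.

Lemma pascal_colE p j :
  pascal_col p j = 1 / \prod_(l < n) (1 - p%:~R * mfps_var R l) *
    \prod_(l < n) (mfps_var R l / (1 - p%:~R * mfps_var R l)) ^+ j l.
Proof.
elim/(@mnm_ind n): j => [|j l IH].
  rewrite [X in _ * X]big1 ?mulr1 => [|l _]; last by rewrite mnm0E.
  apply: (mulrI (unit_prod_1BpX p)).
  by rewrite pascal_col0 div1r divrr ?unit_prod_1BpX.
under [X in _ * X]eq_bigr do rewrite mnmDE exprD.
rewrite big_split /= mulrA -IH [X in _ * X](bigD1 l) //= mnm1E eqxx expr1.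
rewrite big1 ?mulr1 => [|i neq_il]; last by rewrite mnm1E eq_sym (negPf neq_il).
(* Cancelling the unit 1 - p z_l turns the column recurrence into multiplication by X_l. *)
apply: (mulrI (unit_1BpX p l)); rewrite pascal_col_addU.
by rewrite [RHS]mulrC -!mulrA mulVr ?unit_1BpX // mulr1 mulrC.
Qed.

End PascalSeries.

(** * The series X_i form a set of variables, with identity Jacobian at 0 *)

Section PascalVariables.
Context {K : fieldType} {n : nat}.

Lemma pascal_variables (p : int) :
  variables_set (fun i : 'I_n => mfps_var K i / (1 - p%:~R * mfps_var K i)).
Proof.
set X := fun i : 'I_n => _; split=> [i|].
  exists (fun j => if j == i then (1 - p%:~R * mfps_var K i)^-1 else 0).
  rewrite (bigD1 i) //= eqxx big1 ?addr0 1?mulrC // => j /negPf->.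
  by rewrite mul0r.
suff -> : mfps_jacobian0 X = 1%:M by rewrite det1 oner_eq0.
apply/matrixP => i j; rewrite !mxE.
rewrite -[LHS]/(X j (0 + U_(i))%MM *+ (0%MM i).+1) mnm0E add0m /X.
have [->|neq_ij] := eqVneq i j; last first.
  by rewrite mfps_mulXE0 // mnm1E (negPf neq_ij).
rewrite -[U_(j)%MM]add0m mfps_mulXE.
(* Comparing constant terms in (1 - p z_j)(1 - p z_j)^-1 = 1 shows that the inverse has constant
   term 1. *)
have := congr1 (fun f : mfps K n => f 0%MM) (mulrV (unit_1BpX p j)).
rewrite mfps_mul1BXE mfps_mulXE0 ?mnm0E // mulr0 subr0 => ->.
by rewrite [LHS]/= !eqxx.
Qed.

End PascalVariables.

Theorem proposition4 (K : fieldType) (n : nat) (hn : (0 < n)%N) :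
  (forall p : int, riordan_element (ltmx_int_to K (pascal n ^ p))) /\
  (forall p : int,
     let G : mfps K n := 1 / \prod_(j < n) (1 - p%:~R * mfps_var K j) in
     let X : 'I_n -> mfps K n :=
       fun i => mfps_var K i / (1 - p%:~R * mfps_var K i) in
     riordan_pair G X /\ ltmx_int_to K (pascal n ^ p) = riordan_mx G X).
Proof.
suff main p :
    let G : mfps K n := 1 / \prod_(j < n) (1 - p%:~R * mfps_var K j) in
    let X : 'I_n -> mfps K n :=
      fun i => mfps_var K i / (1 - p%:~R * mfps_var K i) in
    riordan_pair G X /\ ltmx_int_to K (pascal n ^ p) = riordan_mx G X.
  by split=> // p; eexists; eexists; apply: main.
move=> G X; split.
  split; last exact: pascal_variables.
  by rewrite unitrM unitr1 unitrV unit_prod_1BpX.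
apply/funext => k; apply/funext => j.
(* The map from the integers to K is a ring morphism, so it carries the entries of Q_p to the
   coefficients of the column series. *)
rewrite /riordan_mx -pascal_colE /ltmx_int_to pascal_exprz /= /pascal_coef.
by rewrite rmorphMn rmorphXn.
Qed.
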